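(* Let $\sigma$ be a probability measure with $\sigma([0,1])=1$. Fix an integer $k\ge2$ and suppose that there exists $0<\varepsilon<1$ such that $$\frac{\varepsilon}{\sigma^t_\varepsilon([0,1])}<\frac{2}{2k+7}.$$ Fix such an $\varepsilon$ and let $$\rho:=(k-1)R_{\sigma'_\varepsilon}\left(\frac{2}{2k+7}\right),\qquad r:=\frac{\rho}{6(k+3)}\left(\frac{\rho}{12e}\right)^{k-1}.$$ Then for any integer $n\ge\max\left(\frac{1}{r\,\sigma^t_\varepsilon([0,1])},\frac{2k+6}{\varepsilon}\right)$ there exist (not necessarily distinct) $x_1,\dots,x_n\in[0,1]$ satisfying $$\frac1n\sum_{i=1}^n x_i^j=\int x^j d\sigma(x)\quad\text{for all integers }1\le j\le k.$$
   Context: For a probability measure $\sigma$ on $\mathbb{R}$ and $0<\varepsilon<1$, define $$\sigma^t_\varepsilon:=\sigma-\sum_{\{x\,:\,\sigma(\{x\})>\varepsilon\}}(\sigma(\{x\})-\varepsilon)\delta_x,\qquad \sigma'_\varepsilon:=\frac{\sigma^t_\varepsilon}{\sigma^t_\varepsilon(\mathbb{R})},$$ i.e. $\sigma^t_\varepsilon$ is $\sigma$ with all its atoms truncated to mass $\varepsilon$ and $\sigma'_\varepsilon$ is its normalization. For a probability measure $\mu$ on $\mathbb{R}$ and $0<\delta<1$, $R_\mu(\delta):=\min\left(|x-y|\ :\ x,y\in\mathbb{R},\ \mu([x,y])\ge\delta\right)$. *)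

(* Defs.v *)
From HB Require Import structures.
From mathcomp Require Import all_boot all_order all_algebra.
From mathcomp Require Import all_classical all_reals all_analysis.

Set Implicit Arguments.
Unset Strict Implicit.
Unset Printing Implicit Defensive.

Import Order.TTheory GRing.Theory Num.Theory.
Import numFieldNormedType.Exports.

Local Open Scope classical_set_scope.
Local Open Scope ring_scope.
Local Open Scope ereal_scope.

(* For 0 < eps the index set is finite, and all summands are nonnegative
   (as [\esum] requires). *)
Definition atom_trunc (R : realType) (sigma : set R -> \bar R) (eps : R)
    (A : set R) : \bar R :=
  sigma A - \esum_(x in [set x | eps%:E < sigma [set x]])
              ((sigma [set x] - eps%:E) * \d_x A).

Definition atom_trunc_normalized (R : realType) (sigma : set R -> \bar R)
    (eps : R) (A : set R) : \bar R :=
  atom_trunc sigma eps A / atom_trunc sigma eps setT.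

(* When mu is a probability measure and 0 < delta < 1 this infimum is a minimum:
   the set is nonempty, a minimizing sequence of intervals stays bounded, and
   mu is continuous from above.  If y < x then [x, y] is empty and does not
   contribute, as mu set0 = 0 < delta. *)
Definition min_length (R : realType) (mu : set R -> \bar R) (delta : R) : R :=
  inf [set d : R | exists x y : R, delta%:E <= mu `[x, y]%classic /\
                                   d = `|x - y|%R].

(* Main.v *)
Require Import Defs.
From HB Require Import structures.
From mathcomp Require Import all_boot all_order all_algebra.
From mathcomp Require Import all_classical all_reals all_analysis.
From mathcomp Require Import measurable_realfun polyrcf zify ring lra.
Import Order.TTheory GRing.Theory Num.Theory.
Import numFieldNormedType.Exports.
Local Open Scope classical_set_scope.
Local Open Scope ring_scope.

(* Let M be the mass of the truncated measure.  Cut the truncated measure and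
   the removed excess into pieces of mass 1/n each: the cut points form an
   n-point measure whose distribution function is within 2/n of that of sigma,
   so all its moments are within 2/n of those of sigma.  It remains to correct
   this error.  With T about n M / (k + 3), the quantile points
   x_s, x_(s+T), ..., x_(s+(k+1)T) of the truncated measure are pairwise at
   distance at least R, and for each s < T the k inner ones may be moved so as
   to change their first k power sums by any prescribed vector of size at most
   2/T (Kuperberg's method): by Newton's identities such a change perturbs the
   coefficients of P(z) = prod (z - y_i) only slightly, so that the perturbed
   polynomial still alternates in sign at the midpoints between the y_i, and
   its k real roots are the new points.  Distributing the moment error evenly
   among the T groups gives the theorem. *)

Set Implicit Arguments.
Unset Strict Implicit.
Unset Printing Implicit Defensive.

(** * Newton's identities and perturbation of power sums *)

Lemma dvdXnP (F : fieldType) n (p : {poly F}) :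
  reflect (forall m, (m < n)%N -> p`_m = 0) ('X^n %| p).
Proof.
rewrite /dvdp -Pdiv.IdomainMonic.take_poly_modp; apply: (iffP eqP) => [p0 m mn|p0].
  by have := coef_take_poly n p m; rewrite p0 mn coef0.
by apply/polyP => m; rewrite coef_take_poly coef0; case: ifP => // /p0.
Qed.

(** The constant coefficient is forced to 0 because Newton's identities involve only the power sums
    of exponents 1 to [k]. *)
Definition genpoly (F : nzRingType) k (a : nat -> F) : {poly F} :=
  \poly_(j < k.+1) (if j == 0%N then 0 else a j).

(* [newton k p C] says that C is, modulo t^(k+1) and up to a constant factor,
   the exponential of - sum_j p_j t^j / j; for C = prod (1 - y_i t) this is
   Newton's identity relating elementary symmetric polynomials to the power
   sums p_j. *)
Definition newton (F : fieldType) k (p C : {poly F}) :=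
  'X^(k.+1) %| 'X * C^`() + p * C.

Section Newton.
Variable F : fieldType.
Implicit Types (p q C D : {poly F}) (k : nat).

Lemma coef_newton C p m :
  ('X * C^`() + p * C)`_m = m%:R * C`_m + (p * C)`_m.
Proof.
rewrite coefD coefXM coef_deriv; case: m => [|m] /=; first by rewrite mul0r.
by rewrite mulr_natl.
Qed.

Lemma newton1 k : newton k 0 (1 : {poly F}).
Proof. by rewrite /newton derivC mulr0 mul0r addr0 dvdp0. Qed.

(** Logarithmic derivatives add under multiplication. *)
Lemma newtonM k p q C D :
  newton k p C -> newton k q D -> newton k (p + q) (C * D).
Proof.
rewrite /newton => hC hD.
rewrite (_ : _ + _ = D * ('X * C^`() + p * C) + C * ('X * D^`() + q * D)).
  by rewrite dvdp_add// dvdp_mull.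
by rewrite derivM; ring.
Qed.

Lemma newton_take k p C : newton k p C -> newton k p (take_poly k.+1 C).
Proof.
move=> /dvdXnP h; apply/dvdXnP => m mk; rewrite -[RHS](h m mk) !coef_newton.
rewrite coef_take_poly mk !coefM; congr (_ + _); apply: eq_bigr => i _.
by rewrite coef_take_poly (leq_ltn_trans (leq_subr _ _) mk).
Qed.

(** The geometric series: [y t / (1 - y t)] expands as the sum of the [y^j t^j] with [j >= 1]. *)
Lemma newton_linear k (y : F) :
  newton k (genpoly k (fun j => y ^+ j)) (1 - y *: 'X).
Proof.
apply/dvdXnP => m mk; rewrite coefD derivB derivZ derivX derivC sub0r.
rewrite mulrBr mulr1 -scalerAr coefB coefZ coefMX mulrN coefN.
rewrite -scalerAr mulr1 coefZ coefX /genpoly !coef_poly mk.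
case: m mk => [|[|m]] mk //=; rewrite ?mulr0 ?mulr1; first by rewrite subr0 oppr0 add0r.
  by rewrite expr1 subr0 addNr.
by rewrite (ltnW mk) oppr0 add0r exprS subrr.
Qed.

Lemma newton_prod k n (y : nat -> F) :
  newton k (genpoly k (fun j => \sum_(i < n) y i ^+ j))
    (\prod_(i < n) (1 - y i *: 'X)).
Proof.
elim: n => [|n IHn].
  rewrite big_ord0 (_ : genpoly _ _ = 0) ?newton1//.
  apply/polyP => m; rewrite coef_poly coef0; case: ifP => // _.
  by case: eqP => // _; rewrite big_ord0.
rewrite big_ord_recr /=; set p := genpoly _ _.
rewrite (_ : p = genpoly k (fun j => \sum_(i < n) y i ^+ j) +
                 genpoly k (fun j => y n ^+ j)).
  exact: newtonM (newton_linear _ _).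
apply/polyP => m; rewrite coefD !coef_poly; case: ifP => // _; last by rewrite addr0.
by case: eqP => // _; rewrite ?addr0// big_ord_recr.
Qed.

(** A polynomial with nonzero constant coefficient is invertible modulo [X^(k+1)]. Hence equal
    products of linear factors have equal power sums. *)
Lemma newton_inj k p q C : C`_0 != 0 ->
  newton k p C -> newton k q C -> forall m, (m <= k)%N -> p`_m = q`_m.
Proof.
move=> C0 hp hq m mk; have : 'X^(k.+1) %| (p - q) * C.
  rewrite (_ : _ * _ = ('X * C^`() + p * C) - ('X * C^`() + q * C)).
    by rewrite dvdp_sub.
  by ring.
rewrite Gauss_dvdpl; last first.
  by rewrite coprimep_expl// coprimep_sym coprimepX /root horner_coef0.
by move=> /dvdXnP /(_ m mk) /eqP; rewrite coefB subr_eq0 => /eqP.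
Qed.

End Newton.

Section NewtonSol.
Variable F : realFieldType.

(** The coefficients are solved for one by one from [m H_m = - (V H)_m]. The right side has [m]
    terms, each at most the bound because earlier coefficients are at most 1, and division by [m]
    restores the bound. *)
Lemma newton_sol k (v : nat -> F) (d : F) : d <= 1 ->
  (forall j, (0 < j <= k)%N -> `|v j| <= d) ->
  exists H : {poly F}, [/\ newton k (genpoly k v) H, H`_0 = 1 &
    forall m, (0 < m)%N -> `|H`_m| <= Num.max d 0].
Proof.
move=> d1 hv; set V := genpoly k v.
suff [H [_ hN H0 hH]] : exists H : {poly F}, [/\ (size H <= k.+1)%N, newton k V H,
    H`_0 = 1 & forall m, (0 < m)%N -> `|H`_m| <= Num.max d 0].
  by exists H.
have hV m : `|V`_m| <= Num.max d 0.
  rewrite coef_poly; case: ifP => [mk|_]; last by rewrite normr0 le_max lexx orbT.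
  case: eqP => [_|/eqP m0]; first by rewrite normr0 le_max lexx orbT.
  by rewrite le_max hv// lt0n m0.
have V0 : V`_0 = 0 by rewrite coef_poly.
have D1 : Num.max d 0 <= 1 by rewrite ge_max d1 ler01.
have D0 : 0 <= Num.max d 0 by rewrite le_max lexx orbT.
move: (Num.max d 0) hV D1 D0 => D hV D1 D0.
(* The induction raises only the precision [K] of the relation; the polynomial [V] stays fixed. *)
elim: {1 2}k => [|K [H [sH hN H0 hH]]].
  exists 1; split; rewrite ?size_poly1 ?coef1//.
    by apply/dvdXnP => -[|//] _; rewrite coef_newton mul0r add0r mulr1.
  by case=> // m _; rewrite coef1 normr0.
(* This is the value that cancels the coefficient of degree [K.+1]. Since [V] has no constant term,
   the new monomial does not feed back through [V * H] in that degree. *)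
pose c := - (V * H)`_K.+1 / K.+1%:R.
have K0 : (K.+1%:R : F) != 0 by rewrite pnatr_eq0.
exists (H + c *: 'X^(K.+1)); split.
- rewrite (leq_trans (size_polyD _ _))// geq_max (leq_trans sH)//.
  by rewrite (leq_trans (size_scale_leq _ _))// size_polyXn.
- apply/dvdXnP => m; rewrite ltnS => mK.
  rewrite coef_newton mulrDr coefD -scalerAr coefD !coefZ coefXn coefMXn.
  move: mK; rewrite leq_eqVlt => /orP[/eqP ->|mK].
    rewrite eqxx ltnn subnn V0 !mulr0 addr0 mulr1 [H`_K.+1]nth_default// add0r.
    by rewrite /c mulrCA divff// mulr1 addNr.
  rewrite mK (ltn_eqF mK) !mulr0 !addr0.
  by move/dvdXnP : hN => /(_ m mK); rewrite coef_newton.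
- by rewrite coefD H0 coefZ coefXn mulr0 addr0.
move=> m m0; rewrite coefD coefZ coefXn.
have [->|_] := eqVneq m K.+1; last by rewrite mulr0 addr0 hH.
rewrite [H`_K.+1]nth_default// add0r mulr1 /c mulNr normrN normrM normfV.
rewrite (@ger0_norm _ (K.+1%:R))// ler_pdivrMr ?ltr0n//.
rewrite coefM big_ord_recl /= V0 mul0r add0r.
apply: le_trans (ler_norm_sum _ _ _) _.
rewrite [leRHS](_ : _ = \sum_(i < K.+1) D); last first.
  by rewrite sumr_const card_ord mulr_natr.
apply: ler_sum => i _; rewrite normrM -[leRHS]mulr1 ler_pM//.
case: (K.+1 - bump 0 i)%N => [|l]; first by rewrite H0 normr1.
by rewrite (le_trans (hH _ _)).
Qed.

End NewtonSol.

(** * Binomial bound, reversed polynomials and products of linear factors *)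

Lemma bin_le_exp2 n m : ('C(n.+1, m) <= 2 ^ n)%N.
Proof.
elim: n m => [|n IHn] [|m]; rewrite ?bin0 ?bin1 ?expn_gt0//.
  by rewrite binS !bin0n; case: m.
by rewrite binS expnS mul2n -addnn leq_add.
Qed.

Lemma horner_rev (F : fieldType) k (U : {poly F}) z : (size U <= k.+1)%N ->
  z != 0 -> (\poly_(i < k.+1) U`_(k - i)).[z] = z ^+ k * U.[z^-1].
Proof.
move=> sU z0; rewrite horner_poly (horner_coef_wide _ sU) mulr_sumr.
rewrite (reindex_inj rev_ord_inj) /=; apply: eq_bigr => i _.
have ik : (i <= k)%N by rewrite -ltnS.
rewrite subSS subKn// mulrCA; congr (_ * _).
by rewrite exprVn expfB_cond ?(negbTE z0)//.
Qed.

Lemma size_prod_linear (F : fieldType) n (y : nat -> F) :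
  (size (\prod_(i < n) (1 - y i *: 'X))%R <= n.+1)%N.
Proof.
elim: n => [|n IHn]; first by rewrite big_ord0 size_poly1.
rewrite big_ord_recr /= mulrBr mulr1 -scalerAr.
rewrite (leq_trans (size_polyD _ _))// geq_max size_polyN.
rewrite (leq_trans IHn)//= (leq_trans (size_scale_leq _ _))//.
by rewrite (leq_trans (size_polyMleq _ _))// size_polyX addn2.
Qed.

Lemma coef0_prod_linear (F : fieldType) n (y : nat -> F) :
  (\prod_(i < n) (1 - y i *: 'X))`_0 = 1.
Proof.
rewrite -horner_coef0 horner_prod big1// => i _.
by rewrite hornerD hornerN hornerZ hornerX hornerC mulr0 subr0.
Qed.

Lemma horner_prod_linear (F : fieldType) k (y : nat -> F) z : z != 0 ->
  z ^+ k * (\prod_(i < k) (1 - y i *: 'X)).[z^-1] = \prod_(i < k) (z - y i).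
Proof.
move=> z0; rewrite horner_prod -[k in z ^+ k]card_ord -prodr_const -big_split /=.
by apply: eq_bigr => i _; rewrite !hornerE; field.
Qed.

(** Multiplying by [1 - y X] with [0 <= y <= 1] at most doubles the sum of the absolute values of
    the coefficients. *)
Lemma sum_norm_coef_prod_linear (F : realFieldType) n (y : nat -> F) K :
  (forall i, (i < n)%N -> 0 <= y i <= 1) ->
  \sum_(i < K) `|(\prod_(i < n) (1 - y i *: 'X))`_i| <= 2 ^+ n.
Proof.
elim: n K => [|n IHn] K hy.
  rewrite big_ord0 expr0; case: K => [|K]; first by rewrite big_ord0 ler01.
  rewrite big_ord_recl coef1 eqxx normr1 big1 ?addr0// => i _.
  by rewrite coef1 normr0.
rewrite big_ord_recr /=; set C := \prod_(i < n) _.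
have hC K' : \sum_(i < K') `|C`_i| <= 2 ^+ n.
  by apply: IHn => i ni; apply: hy; rewrite (ltn_trans ni).
rewrite exprS mulr_natl mulr2n.
have /andP[y0 y1] := hy n (ltnSn n).
apply: le_trans (_ : \sum_(i < K) (`|C`_i| + `|(C * 'X)`_i|) <= _).
  apply: ler_sum => i _; rewrite mulrBr mulr1 -scalerAr coefB coefZ.
  rewrite (le_trans (ler_normB _ _))// lerD2l normrM ler_piMl//.
  by rewrite ger0_norm.
rewrite big_split lerD//; case: K => [|K]; first by rewrite big_ord0 exprn_ge0.
rewrite big_ord_recl coefMX /= normr0 add0r.
rewrite (eq_bigr (fun i : 'I_K => `|C`_i|)) ?hC// => i _.
by rewrite coefMX.
Qed.

(** * Moving separated nodes to prescribe their power sums *)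

Section Perturb.
Variables (R : rcfType) (k : nat) (y : nat -> R) (r : R).
Hypothesis r0 : 0 < r.
Hypothesis yr : forall i, (i <= k)%N -> y i + r <= y i.+1.

Lemma node_gap i j : (i <= j <= k.+1)%N -> (j - i)%:R * r <= y j - y i.
Proof.
elim: j => [|j IHj] /andP[ij jk].
  by move: ij; rewrite leqn0 => /eqP ->; rewrite subnn mul0r subrr.
move: ij; rewrite leq_eqVlt => /orP[/eqP ->|]; first by rewrite subnn mul0r subrr.
rewrite ltnS => ij; rewrite subSn// mulrS mulrDl mul1r.
have := IHj; rewrite ij (ltnW jk) => /(_ isT).
by have := yr jk; lra.
Qed.

(** The nodes to be moved are [y 1], ..., [y k]; with [y 0] and [y k.+1] as outer neighbours, the
    midpoints 0 to [k] interlace with them. *)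
Definition midnode l := (y l + y l.+1) / 2.

(** The [j]-th nearest node on either side of the midpoint is at distance at least
    [(j - 1/2) r >= j r / 2], so the two sides give two factorials. The sign counts the [k - l]
    nodes on the right. *)
Lemma prod_midnode l : (l <= k)%N ->
  (r / 2) ^+ k * (l`! * (k - l)`!)%:R <=
  (-1) ^+ (k - l) * \prod_(i < k) (midnode l - y i.+1).
Proof.
move=> lk.
have -> : (-1) ^+ (k - l) * \prod_(i < k) (midnode l - y i.+1) =
  \prod_(i < l) (midnode l - y i.+1) *
  \prod_(i < k - l) (y (l + i).+1 - midnode l).
  rewrite -(big_mkord xpredT (fun i => midnode l - y i.+1)) (big_cat_nat (n := l))//=.
  rewrite big_mkord mulrCA; congr (_ * _).
  rewrite -[X in \prod_(X <= i < _) _]add0n big_addn big_mkord.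
  rewrite -[X in _ ^+ X]card_ord -prodr_const -big_split /=.
  by apply: eq_bigr => i _; rewrite mulN1r opprB addnC.
rewrite -{1}(subnKC lk) exprD natrM mulrACA.
have rr : 0 < r / 2 by rewrite divr_gt0.
apply: ler_pM; rewrite ?mulr_ge0 ?exprn_ge0 ?(ltW rr)//.
  rewrite -ffactnn ffact_prod natr_prod -[X in _ ^+ X]card_ord -prodr_const.
  rewrite -big_split /=; apply: ler_prod => i _; rewrite mulr_ge0 ?(ltW rr)//=.
  have il : (i < l)%N by [].
  have := @node_gap i.+1 l; rewrite il (leq_trans lk)// => /(_ isT).
  have := yr lk; rewrite /midnode.
  have -> : (l - i)%:R = (l - i.+1)%:R + 1 :> R by rewrite subnS natr1 prednK ?subn_gt0.
  have : 0 <= (l - i.+1)%:R * r by rewrite mulr_ge0// ltW.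
  by move: ((l - i.+1)%:R) => D; lra.
rewrite fact_prod big_add1 /= big_mkord natr_prod.
rewrite -[X in _ ^+ X]card_ord -prodr_const -big_split /=.
apply: ler_prod => i _; rewrite mulr_ge0 ?(ltW rr)//=.
have il : (i < k - l)%N by [].
have := @node_gap l.+1 (l + i).+1.
rewrite ltnS leq_addr ltnS subSS addKn.
have -> : (l + i <= k)%N by rewrite -leq_subRL// ltnW.
move=> /(_ isT).
have := yr lk; rewrite /midnode -[i.+1%:R]natr1.
have : 0 <= i%:R * r by rewrite mulr_ge0// ltW.
move: (i%:R : R) => D; lra.
Qed.

(** Multiplying [C] by the solution [H] of Newton's identities for [v] adds [v] to the power sums.
    The values at the midpoints, which lie in []0, 1]], change by at most [d k 2^k]. The last
    hypothesis on [d] keeps this below the bound of [prod_midnode], so all signs survive. *)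
Lemma perturb_power_sums (v : nat -> R) (d : R) : (0 < k)%N ->
  0 <= y 0%N -> y k.+1 <= 1 -> 0 <= d <= 1 ->
  (forall j, (1 <= j <= k)%N -> `|v j| <= d) ->
  d * k%:R * 2 ^+ k < (r / 2) ^+ k * k`!%:R / 2 ^+ k.-1 ->
  exists a : nat -> R, (forall i, (i < k)%N -> 0 <= a i <= 1) /\
   forall j, (1 <= j <= k)%N ->
     \sum_(i < k) a i ^+ j = \sum_(i < k) y i.+1 ^+ j + v j.
Proof.
move=> k0 y0 y1 /andP[d0 d1] vd hd.
have [H [NH H0]] := newton_sol d1 vd.
rewrite (max_l d0) => Hd.
pose C := \prod_(i < k) (1 - y i.+1 *: 'X).
pose U := take_poly k.+1 (C * H).
have yy i : (i <= k.+1)%N -> 0 <= y i <= 1.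
  move=> ik; have := @node_gap 0 i; rewrite ik => /(_ isT).
  have := @node_gap i k.+1; rewrite ik leqnn => /(_ isT).
  have : 0 <= (i - 0)%:R * r by rewrite mulr_ge0// ltW.
  have : 0 <= (k.+1 - i)%:R * r by rewrite mulr_ge0// ltW.
  by lra.
have hm l : (l <= k)%N -> 0 < midnode l <= 1.
  move=> lk; have := yr lk; have := yy l; have := yy l.+1.
  rewrite !ltnS lk (leq_trans lk)// /midnode => /(_ isT)/andP[_ h] /(_ isT)/andP[h' _] hr.
  by apply/andP; split; move: r0 h h' hr; lra.
have NU : newton k (genpoly k (fun j => \sum_(i < k) y i.+1 ^+ j + v j)) U.
  (* [C * H] may have degree above [k]; truncation preserves the relation modulo [X^(k+1)]. *)
  apply: newton_take.
  have -> : genpoly k (fun j => \sum_(i < k) y i.+1 ^+ j + v j) =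
    genpoly k (fun j => \sum_(i < k) y i.+1 ^+ j) + genpoly k v.
    apply/polyP => m; rewrite coefD !coef_poly; case: ifP; rewrite ?addr0//.
    by case: eqP; rewrite ?addr0.
  exact: newtonM (newton_prod k k (fun i => y i.+1)) NH.
have C0 : C`_0 = 1 by exact: (coef0_prod_linear k (fun i => y i.+1)).
have sC : (size C <= k.+1)%N by exact: (size_prod_linear k (fun i => y i.+1)).
have sU : (size U <= k.+1)%N by exact: size_take_poly.
have U0 : U`_0 = 1.
  by rewrite coef_take_poly /= coefM big_ord1 C0 H0 mulr1.
(* [Q] is [z^k U(1/z)], the perturbed version of the product of the [z - y i.+1]. *)
pose Q := \poly_(i < k.+1) U`_(k - i).
(* The constant coefficient is unchanged, so only [k] coefficients contribute to the error and [Q]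
   stays monic. *)
have UC m : (m <= k)%N -> `|U`_m - C`_m| <= if m == 0%N then 0 else d * 2 ^+ k.
  move=> mk; case: eqP => [->|/eqP m0]; first by rewrite U0 C0 subrr normr0.
  rewrite coef_take_poly ltnS mk coefM big_ord_recr /= subnn H0 mulr1 addrK.
  rewrite (le_trans (ler_norm_sum _ _ _))//.
  apply: le_trans (_ : \sum_(i < m) d * `|C`_i| <= _).
    apply: ler_sum => i _; rewrite normrM mulrC ler_wpM2r// Hd//.
    by rewrite subn_gt0.
  rewrite -mulr_sumr ler_wpM2l//.
  by apply: (@sum_norm_coef_prod_linear _ k (fun i => y i.+1)) => i ik; apply: yy; lia.
have Qsgn l : (l <= k)%N -> 0 < (-1) ^+ (k - l) * Q.[midnode l].
  move=> lk; have /andP[z0 z1] := hm l lk; set z := midnode l in z0 z1 *.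
  have zN0 : z != 0 by rewrite gt_eqF.
  have : `|Q.[z] - \prod_(i < k) (z - y i.+1)| <= d * k%:R * 2 ^+ k.
    rewrite -(horner_prod_linear k (fun i => y i.+1))// horner_rev//.
    rewrite -mulrBr (horner_coef_wide _ sU) (horner_coef_wide _ sC) -sumrB mulr_sumr.
    rewrite (le_trans (ler_norm_sum _ _ _))//.
    apply: le_trans (_ : \sum_(i < k.+1) (if i == 0 :> nat then 0 else d * 2 ^+ k) <= _).
      apply: ler_sum => i _; have ik : (i <= k)%N by rewrite -ltnS.
      apply: le_trans (UC i ik); rewrite -mulrBl mulrCA normrM ler_piMr//.
      rewrite (_ : _ * _ = z ^+ (k - i)); last first.
        by rewrite exprVn expfB_cond ?(negbTE zN0).
      by rewrite ger0_norm ?exprn_ge0 ?exprn_ile1// ltW.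
    rewrite big_ord_recl /= add0r sumr_const card_ord.
    by rewrite -[_ *+ k]mulr_natr mulrAC.
  have := prod_midnode lk; rewrite -/z; set P := \prod_(i < k) _ => hP.
  (* The quotient of [k!] by the product of factorials is a binomial coefficient, at most [2^(k-1)]
     by [bin_le_exp2]. *)
  have hf : k`!%:R / 2 ^+ k.-1 <= (l`! * (k - l)`!)%:R :> R.
    rewrite ler_pdivrMr ?exprn_gt0// -natrX -natrM ler_nat.
    have := bin_fact lk; rewrite mulnC => <-; rewrite leq_mul2l.
    by apply/orP; right; move: (bin_le_exp2 k.-1 l); rewrite prednK.
  have : d * k%:R * 2 ^+ k < (-1) ^+ (k - l) * P.
    rewrite (lt_le_trans hd)// (le_trans _ hP)// -mulrA ler_wpM2l//.
    by rewrite exprn_ge0// divr_ge0// ltW.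
  have : `|(-1) ^+ (k - l) * (Q.[z] - P)| = `|Q.[z] - P|.
    by rewrite normrM normrX normrN1 expr1n mul1r.
  rewrite mulrBr.
  have := ler_norm (- ((-1) ^+ (k - l) * Q.[z] - (-1) ^+ (k - l) * P)).
  rewrite normrN; lra.
(* Consecutive midpoints carry opposite signs of [Q]. The value 0 for [l >= k] only makes the
   function total for [choice]. *)
have hroot l : exists c, (l < k)%N -> midnode l < c < midnode l.+1 /\ root Q c.
  have [lk|_] := ltnP l k; last by exists 0.
  have z1 : midnode l <= midnode l.+1.
    by have := yr lk; have := yr (ltnW lk); rewrite /midnode; move: r0; lra.
  have [|c] := @poly_ivtoo R Q _ _ z1.
    have := mulr_gt0 (Qsgn l (ltnW lk)) (Qsgn l.+1 lk).
    rewrite -(subnSK lk) exprS; set s := (-1) ^+ _; set q1 := Q.[_]; set q2 := Q.[_].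
    have ss : s * s = 1 by rewrite -expr2 /s sqrr_sign.
    by rewrite mulN1r !mulNr mulrACA ss mul1r oppr_gt0.
  by rewrite in_itv /= => h1 h2; exists c.
have [a ha] := choice hroot.
have a01 i : (i < k)%N -> 0 < a i <= 1.
  move=> ik; have [/andP[h1 h2] _] := ha i ik.
  have /andP[m0 _] := hm i (ltnW ik); have /andP[_ m1] := hm _ ik.
  by rewrite (lt_trans m0)//= (le_trans (ltW h2)).
have amono i j : (i < j < k)%N -> a i < a j.
  move=> /andP[ij jk]; have [/andP[_ h2] _] := ha i (ltn_trans ij jk).
  have [/andP[h3 _] _] := ha j jk; apply: lt_trans h2 (le_lt_trans _ h3).
  have := @node_gap i.+1 j; have := @node_gap i.+2 j.+1.
  rewrite !ltnS ij (ltnW jk) (leq_trans (ltnW jk))//= => /(_ isT) + /(_ isT).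
  have : 0 <= (j - i.+1)%:R * r by rewrite mulr_ge0// ltW.
  have : 0 <= (j.+1 - i.+2)%:R * r by rewrite mulr_ge0// ltW.
  by rewrite /midnode; lra.
exists a; split => [i ik|j /andP[j0 jk]].
  by have /andP[/ltW -> ->] := a01 i ik.
(* Both sides have degree at most [k] and agree at the [k + 1] distinct points 0 and [1 / a i]. *)
have UE : U = \prod_(i < k) (1 - a i *: 'X).
  apply/eqP; rewrite -subr_eq0; apply/eqP.
  pose rs := 0 :: [seq (a i)^-1 | i <- iota 0 k].
  apply: (@roots_geq_poly_eq0 _ _ rs).
  - rewrite /= /root hornerD hornerN !horner_coef0 U0 coef0_prod_linear subrr eqxx /=.
    apply/allP => _ /mapP[i + ->]; rewrite mem_iota add0n => /= ik.
    have /andP[ai0 _] := a01 i ik; have aN0 : a i != 0 by rewrite gt_eqF.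
    have [_ /rootP] := ha i ik; rewrite horner_rev// => /eqP.
    rewrite mulf_eq0 expf_eq0 (negbTE aN0) andbF /= => /eqP Ua.
    rewrite /root hornerD hornerN Ua sub0r oppr_eq0 horner_prod.
    apply/prodf_eq0; exists (Ordinal ik) => //=.
    by rewrite hornerD hornerN hornerZ hornerX hornerC mulfV// subrr.
  - rewrite /= map_inj_in_uniq ?iota_uniq ?andbT.
      apply/mapP => -[i]; rewrite mem_iota add0n => /= ik.
      by have /andP[ai0 _] := a01 i ik => /esym/eqP; rewrite invr_eq0 gt_eqF.
    move=> i j'; rewrite !mem_iota !add0n /= => ik jk' /invr_inj aij.
    case: (ltngtP i j') => // ij.
      by have := amono i j'; rewrite ij jk' aij ltxx => /(_ isT).
    by have := amono j' i; rewrite ij ik aij ltxx => /(_ isT).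
  rewrite /= size_map size_iota (leq_trans (size_polyD _ _))// size_polyN geq_max sU.
  exact: size_prod_linear.
have := newton_prod k k a; rewrite -UE => NU'.
have := newton_inj _ NU' NU jk; rewrite U0 oner_eq0 => /(_ isT).
by rewrite !coef_poly ltnS jk; case: eqP j0 => // ->.
Qed.

End Perturb.

(** * Numerical estimate for the admissible perturbation *)

Section Numeric.
Variable R : realType.

(** A weak Stirling bound, by induction from [(1 + 1/n)^n <= e]; the factor 2 comes from [2 <= e] at
    [m = 1]. *)
Lemma expnn_fact_le m : (0 < m)%N ->
  2 * m%:R ^+ m <= m`!%:R * (expR 1 : R) ^+ m.
Proof.
case: m => // m _; elim: m => [|m IHm].
  by rewrite !expr1 mulr1 mul1r; have := expR_ge1Dx (1 : R); lra.
set n := m.+1 in IHm *.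
have n0 : 0 < n%:R :> R by rewrite ltr0n.
have h : n.+1%:R ^+ n <= (expR 1 : R) * n%:R ^+ n.
  rewrite -{2}(@divff R n%:R) ?gt_eqF// expRM_natl -exprMn lerXn2r ?nnegrE ?mulr_ge0 ?expR_ge0//.
  have -> : n.+1%:R = (1 + n%:R^-1) * n%:R :> R.
    by rewrite -natr1; move: (n%:R : R) n0 => t t0; field; rewrite gt_eqF.
  by rewrite ler_pM2r// expR_ge1Dx.
rewrite factS natrM [in leLHS]exprS [in leRHS]exprS.
apply: le_trans (_ : n.+1%:R * (expR 1 * (2 * n%:R ^+ n)) <= _).
  rewrite mulrCA ler_wpM2l// mulrCA ler_wpM2l//.
rewrite [leRHS](_ : _ = n.+1%:R * (expR 1 * (n`!%:R * expR 1 ^+ n))); last by ring.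
by rewrite !ler_wpM2l ?expR_ge0.
Qed.

Lemma le_exp_3half m : m%:R <= (3 / 2 : R) ^+ m.
Proof.
elim: m => [|[|m] IHm]; rewrite ?expr0 ?expr1 ?ler01//; first by lra.
case: m IHm => [_|m IHm]; first by rewrite expr2; lra.
rewrite exprS -natr1; have : 2 <= m.+2%:R :> R by rewrite ler_nat.
by move: IHm; move: (m.+2%:R : R) => t; lra.
Qed.

(** Used with [m = k - 1] and [r] the node spacing, so that [m r] is [rho]. The 12 splits as
    [4 * 2 * (3/2)]: the 4 and the first 2 match the powers of 2 in the conclusion, and [(2/3)^m]
    absorbs a stray factor [m]. *)
Lemma perturbation_size m (r d : R) : (0 < m)%N -> 0 < r ->
  d <= m%:R * r / 3 * (m%:R * r / (12 * expR 1)) ^+ m ->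
  d * m.+1%:R * 2 ^+ m.+1 < (r / 2) ^+ m.+1 * m.+1`!%:R / 2 ^+ m.
Proof.
move=> m0 r0 hd.
have mR : 0 < m%:R :> R by rewrite ltr0n.
pose W := m%:R ^+ m / (expR 1 : R) ^+ m.
have e0 : 0 < (expR 1 : R) ^+ m by rewrite exprn_gt0 ?expR_gt0.
have W0 : 0 < W by rewrite divr_gt0 ?exprn_gt0.
have hW : 2 * W <= m`!%:R by rewrite mulrA ler_pdivrMr// expnn_fact_le.
have hq : m%:R * (2 / 3) ^+ m <= 1 :> R.
  apply: le_trans (ler_wpM2r _ (le_exp_3half m)) _.
    by rewrite exprn_ge0// divr_ge0.
  by rewrite -exprMn (_ : 3 / 2 * (2 / 3) = 1) ?expr1n//; field.
pose A := r ^+ m.+1 * m.+1%:R / 4 ^+ m.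
have A0 : 0 < A by rewrite divr_gt0 ?mulr_gt0 ?exprn_gt0 ?ltr0n.
have -> : (r / 2) ^+ m.+1 * m.+1`!%:R / 2 ^+ m = A * (m`!%:R / 2).
  rewrite factS natrM /A (_ : 4 = 2 * 2 :> R); last by ring.
  by rewrite !exprMn exprVn [2 ^+ m.+1]exprS; field; rewrite ?expf_neq0.
(* The bound on [d] gives exactly this value; strictness then comes from
   [W * (2/3) < W <= m! / 2]. *)
apply: (@le_lt_trans _ _ (A * (W * (2 / 3) * (m%:R * (2 / 3) ^+ m)))).
  rewrite -mulrA; apply: le_trans (ler_wpM2r _ hd) _; first by rewrite mulr_ge0.
  rewrite le_eqVlt; apply/orP; left; apply/eqP; rewrite /A /W.
  rewrite (_ : 12 * expR 1 = 4 * (3 / 2) * 2 * expR 1 :> R); last by field.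
  rewrite ![2^+ m.+1]exprS ![r ^+ m.+1]exprS.
  rewrite !(exprMn, exprVn, invfM).
  by field; rewrite ?expf_neq0 ?gt_eqF ?expR_gt0.
rewrite ltr_pM2l//; apply: le_lt_trans (_ : W * (2 / 3) < _); last by lra.
by rewrite ler_piMr// mulr_ge0// ltW.
Qed.

End Numeric.

(** * Truncation of atoms and quantiles *)

(** The part that [atom_trunc] removes, named separately because it is cut into quantiles as
    well. *)
Definition atom_excess (R : realType) (sigma : set R -> \bar R) (eps : R)
    (A : set R) : \bar R :=
  (\esum_(x in [set x | eps%:E < sigma [set x]])
     ((sigma [set x] - eps%:E) * \d_x A))%E.

Section Excess.
Variables (R : realType) (sigma : probability (measurableTypeR R) R) (eps : R).
Hypothesis eps0 : 0 <= eps.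
Local Notation ex := (atom_excess sigma eps).
Implicit Types A B : set (measurableTypeR R).

Lemma atom_excess_term_ge0 (x : R) A :
  [set x | (eps%:E < sigma [set x])%E] x ->
  (0 <= (sigma [set x] - eps%:E) * \d_x A)%E.
Proof.
move=> /= h; have h0 : (0 <= sigma [set x] - eps%:E)%E by rewrite sube_ge0// ltW.
exact: mule_ge0.
Qed.

Lemma atom_excess_ge0 A : (0 <= ex A)%E.
Proof. by apply: esum_ge0 => x; exact: atom_excess_term_ge0. Qed.

Lemma atom_excessU A B : A `&` B = set0 -> ex (A `|` B) = (ex A + ex B)%E.
Proof.
move=> AB; rewrite -esumD; try by move=> x; exact: atom_excess_term_ge0.
apply: eq_esum => x _; rewrite -ge0_muleDr ?diracE//; congr (_ * _)%E.
rewrite -EFinD; congr (_%:E); rewrite in_setU.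
have : ~ (x \in A /\ x \in B).
  by rewrite !inE => -[Ax Bx]; have : (A `&` B) x by []; rewrite AB.
by case: (x \in A); case: (x \in B) => //= h; rewrite ?addr0 ?add0r//; case: h.
Qed.

(** Each finite partial sum is at most the measure of a finite set of atoms inside [A]. *)
Lemma atom_excess_le A : measurable A -> (ex A <= sigma A)%E.
Proof.
move=> mA; have hle (x : R) : (sigma [set x] - eps%:E <= sigma [set x])%E.
  by rewrite leeBlDr// leeDl// lee_fin.
apply: ge_ereal_sup => _ /= [X [finX XS] <-].
have finXA : finite_set (X `&` A) by exact: finite_setIl.
apply: (@le_trans _ _ (\sum_(x \in X `&` A) sigma [set x])%E).
  rewrite fsbig_mkcondr; apply: lee_fsum => // x /XS/= hx; rewrite diracE.
  case: ifP => _; last by rewrite mule0.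
  by rewrite mule1 hle.
rewrite -measure_fin_bigcup//.
- apply: le_measure; rewrite ?inE//.
    by apply: fin_bigcup_measurable.
  by move=> x [y [_ Ay]] ->.
- by move=> i j _ _ [x [-> ->]].
Qed.

Lemma atom_excess_atom A (p : R) : A p -> (eps%:E < sigma [set p])%E ->
  (sigma [set p] - eps%:E <= ex A)%E.
Proof.
move=> Ap hp; apply: esum_ge; exists [set p]; first by split=> // _ ->.
by rewrite fsbig_set1 diracE mem_set// mule1.
Qed.

End Excess.

(* The total mass, the excess of the large atoms and their difference are three
   set functions to which the same quantile construction applies; only finite
   additivity and domination by [sigma] matter for it. *)
Definition dominated_content (R : realType)
    (sigma : probability (measurableTypeR R) R) (nu : set R -> R) :=
  [/\ forall A : set (measurableTypeR R), measurable A -> 0 <= nu A,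
      forall A : set (measurableTypeR R), measurable A -> nu A <= fine (sigma A) &
      forall A B : set (measurableTypeR R), measurable A -> measurable B ->
        A `&` B = set0 -> nu (A `|` B) = nu A + nu B].

Section Content.
Variables (R : realType) (sigma : probability (measurableTypeR R) R).

Lemma dominated_content_prob : dominated_content sigma (fun A => fine (sigma A)).
Proof.
split=> [A mA|//|A B mA mB AB]; first by rewrite fine_ge0.
by rewrite measureU// fineD// fin_num_measure.
Qed.

Lemma fin_num_atom_excess eps (A : set (measurableTypeR R)) : 0 <= eps ->
  measurable A -> atom_excess sigma eps A \is a fin_num.
Proof.
move=> e0 mA; rewrite ge0_fin_numE ?atom_excess_ge0//.
rewrite (le_lt_trans (atom_excess_le sigma e0 mA))// ltey_eq fin_num_measure//.
Qed.

Lemma fine_atom_trunc eps (A : set (measurableTypeR R)) : 0 <= eps ->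
  measurable A -> fine (atom_trunc sigma eps A) =
    fine (sigma A) - fine (atom_excess sigma eps A).
Proof.
by move=> e0 mA; rewrite -fineB// ?fin_num_measure// fin_num_atom_excess.
Qed.

Lemma dominated_content_excess eps : 0 <= eps ->
  dominated_content sigma (fun A => fine (atom_excess sigma eps A)).
Proof.
move=> e0; split=> [A mA|A mA|A B mA mB AB].
- by rewrite fine_ge0// atom_excess_ge0.
- by rewrite fine_le ?fin_num_measure ?fin_num_atom_excess ?atom_excess_le.
- by rewrite atom_excessU// fineD// fin_num_atom_excess.
Qed.

Lemma dominated_content_trunc eps : 0 <= eps ->
  dominated_content sigma (fun A => fine (atom_trunc sigma eps A)).
Proof.
move=> e0; have [h1 h2 h3] := dominated_content_excess e0.
split=> [A mA|A mA|A B mA mB AB].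
- by rewrite fine_atom_trunc// subr_ge0 h2.
- by rewrite fine_atom_trunc// lerBlDr lerDl h1.
- have mAB := measurableU _ _ mA mB; have := h3 A B mA mB AB.
  have := measureU sigma mA mB AB => /(congr1 fine).
  rewrite fineD ?fin_num_measure// (fine_atom_trunc e0 mA) (fine_atom_trunc e0 mB).
  by rewrite (fine_atom_trunc e0 mAB) => -> ->; rewrite opprD addrACA.
Qed.

Section Dominated.
Variable nu : set R -> R.
Hypothesis hnu : dominated_content sigma nu.
Implicit Types A B : set (measurableTypeR R).

Lemma dominated_content_le A B : measurable A -> measurable B -> A `<=` B ->
  nu A <= nu B.
Proof.
move=> mA mB AB; have [h1 _ h3] := hnu; rewrite -(setDUK AB) h3//.
- by rewrite lerDl h1//; exact: measurableD.
- exact: measurableD.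
- by rewrite setDIK.
Qed.

Lemma dominated_content_cdf x y : x <= y ->
  nu `]-oo, y] = nu `]-oo, x] + nu `]x, y].
Proof.
move=> xy; have [_ _ h3] := hnu; rewrite -h3//.
  congr nu; apply/seteqP; split=> z /=; rewrite !in_itv/=.
    by move=> zy; case: (leP z x) => h; [left|right; rewrite /= ?in_itv/= ?h].
  by move=> [zx|/andP[]//]; apply: le_trans xy.
by apply/seteqP; split=> z //= [] /=; rewrite !in_itv/= => zx /andP[]; rewrite ltNge zx.
Qed.

Lemma dominated_content_cdf_le x y : x <= y -> nu `]-oo, x] <= nu `]-oo, y].
Proof.
move=> xy; rewrite (dominated_content_cdf xy) lerDl; have [h1 _ _] := hnu.
exact: h1.
Qed.

End Dominated.

(** Continuity from above of [sigma] along intervals shrinking to [p]. *)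
Lemma prob_closed_ball (p e : R) : 0 < e ->
  exists2 h, 0 < h & fine (sigma `[p - h, p + h]%classic) <= fine (sigma [set p]) + e.
Proof.
move=> e0; pose F n : set (measurableTypeR R) := `[p - n.+1%:R^-1, p + n.+1%:R^-1]%classic.
have key (z : R) : (forall n, `|z - p| <= n.+1%:R^-1) -> z = p.
  move=> hz; apply/eqP; rewrite -subr_eq0 -normr_le0; apply/ler_addgt0Pl => d d0.
  rewrite addr0; have [n] := ltr_add_invr d0.
  by rewrite add0r => /ltW; apply: le_trans.
have capF : \bigcap_n F n = [set p].
  apply/seteqP; split=> [z /= Fz|z -> n _ /=]; last first.
    by rewrite /F/= in_itv/= lerDl lerBlDr lerDl !invr_ge0 !ler0n.
  apply: (@key z) => n; have := Fz n I; rewrite /F/= in_itv/= => /andP[h1 h2].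
  by rewrite ler_distl; apply/andP; split.
have mF n : measurable (F n) by exact: measurable_itv.
have cvF : (sigma \o F) x @[x --> \oo] --> (fine (sigma [set p]))%:E.
  rewrite fineK ?fin_num_measure// -capF; apply: nonincreasing_cvg_mu => //.
  - by rewrite ltey_eq fin_num_measure.
  - exact: bigcap_measurable.
  - move=> n m nm; apply/subsetPset => z; rewrite /F/= !in_itv/= => /andP[h1 h2].
    have mn : m.+1%:R^-1 <= n.+1%:R^-1 :> R by rewrite lef_pV2 ?posrE ?ltr0n// ler_nat.
    apply/andP; split; first by apply: le_trans h1; rewrite lerD2l lerN2.
    by apply: le_trans h2 _; rewrite lerD2l.
have /fine_cvgP[_ /cvgrPdist_lt /(_ _ e0)[n _ /(_ n (leqnn n))]] := cvF.
rewrite /= distrC => hn; exists n.+1%:R^-1; first by rewrite invr_gt0 ltr0n.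
by rewrite -lerBlDl ltW// (le_lt_trans (ler_norm _)).
Qed.

End Content.

(** * Right-continuity and quantiles of a dominated content *)

Section Quantile.
Variables (R : realType) (sigma : probability (measurableTypeR R) R).
Variable nu : set R -> R.
Hypothesis hnu : dominated_content sigma nu.

(** Right-continuity is inherited from [sigma] by domination, as [nu] itself is only finitely
    additive. *)
Lemma dominated_content_cdf_right (x e : R) : 0 < e ->
  exists2 h, 0 < h & nu `]-oo, x + h] <= nu `]-oo, x] + e.
Proof.
move=> e0; have [h h0 hh] := prob_closed_ball sigma x e0; exists h => //.
rewrite (dominated_content_cdf hnu (_ : x <= x + h)) ?lerDl ?(ltW h0)// lerD2l.
have [_ h2 _] := hnu.
apply: (@le_trans _ _ (fine (sigma `]x, x + h]%classic))); first exact: h2.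
have hP := dominated_content_prob sigma; have [_ _ h3] := hP.
rewrite -(lerD2l (fine (sigma [set x]))) -h3//; last first.
  apply/seteqP; split=> z //= [->] /=; rewrite in_itv/= ltxx//.
apply: le_trans hh; apply: (dominated_content_le hP) => //.
  exact: measurableU.
move=> z [->|] /=; rewrite !in_itv/=.
  by rewrite lerDl lerBlDr lerDl ltW.
move=> /andP[h4 ->]; rewrite andbT; apply: le_trans (ltW h4).
by rewrite lerBlDr lerDl ltW.
Qed.

Hypothesis sigma01 : sigma `[0, 1]%classic = 1%E.

Lemma dominated_content_supp (A : set (measurableTypeR R)) : measurable A ->
  A `&` `[0, 1] = set0 -> nu A = 0.
Proof.
move=> mA A01; have [h1 h2 _] := hnu; apply/eqP; rewrite eq_le h1// andbT.
apply: le_trans (h2 A mA) _.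
have hP := dominated_content_prob sigma; have [_ _ h3] := hP.
have : fine (sigma (A `|` `[0, 1]%classic)) <= 1.
  have mU : measurable (A `|` `[0, 1]%classic) by apply: measurableU.
  by rewrite -lee_fin fineK ?fin_num_measure//; exact: probability_le1.
rewrite h3// sigma01 /=; lra.
Qed.

Lemma dominated_content_full (A : set (measurableTypeR R)) : measurable A ->
  `[0, 1] `<=` A -> nu A = nu `[0, 1].
Proof.
move=> mA A01; have [_ _ h3] := hnu.
have mD : measurable (A `\` `[0, 1]%classic) by exact: measurableD.
rewrite -[in LHS](setDUK A01) h3//; last by rewrite setDIK.
by rewrite (dominated_content_supp mD) ?addr0// setDKI.
Qed.

(** Right-continuity makes the infimum attained, which gives the equivalence for every [x]; [c > 0]
    and the absence of mass below 0 force [w >= 0]. *)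
Lemma quantile_exists (c : R) : 0 < c -> c <= nu `]-oo, 1] ->
  exists2 w, 0 <= w <= 1 & forall x, (w <= x) = (c <= nu `]-oo, x]).
Proof.
move=> c0 c1; pose S := [set x | c <= nu `]-oo, x]].
have S0 : lbound S 0.
  move=> x Sx; rewrite leNgt; apply/negP => x0; move: Sx; rewrite /S /=.
  rewrite dominated_content_supp ?leNgt ?c0//.
  apply/seteqP; split=> z //= []; rewrite !in_itv/= => zx /andP[z0 _].
  by have := le_lt_trans zx x0; rewrite ltNge z0.
have infS : has_inf S by split; [exists 1 | exists 0].
exists (inf S) => [|x].
  apply/andP; split; first by apply: lb_le_inf => //; exists 1.
  by apply: ge_inf => //; exists 0.
apply/idP/idP => [wx|Sx]; last by apply: ge_inf => //; exists 0.
apply/ler_addgt0Pr => e e0.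
have [h h0 hh] := dominated_content_cdf_right x e0.
have [z Sz zh] := inf_adherent h0 infS.
apply: le_trans hh; apply: le_trans (Sz) _.
apply: (dominated_content_cdf_le hnu); apply: ltW (lt_le_trans zh _).
by rewrite lerD2r.
Qed.

Lemma quantiles n : (0 < n)%N -> exists w : nat -> R,
  forall a, a.+1%:R <= n%:R * nu `]-oo, 1] ->
    0 <= w a <= 1 /\ forall x, (w a <= x) = (a.+1%:R <= n%:R * nu `]-oo, x]).
Proof.
move=> n0; have nR : 0 < n%:R :> R by rewrite ltr0n.
suff h a : exists w, a.+1%:R <= n%:R * nu `]-oo, 1] ->
    0 <= w <= 1 /\ forall x, (w <= x) = (a.+1%:R <= n%:R * nu `]-oo, x]).
  by have [w hw] := choice h; exists w.
(* Indices start at 0, so [w a] is the quantile of level [(a + 1)/n]; 0 is a default beyond the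
   total mass. *)
have [ha|_] := leP a.+1%:R (n%:R * nu `]-oo, 1]); last by exists 0.
have [||w w01 hw] := @quantile_exists (a.+1%:R / n%:R).
- by rewrite divr_gt0// ltr0n.
- by rewrite ler_pdivrMr// mulrC.
by exists w; split=> // x; rewrite hw ler_pdivrMr// mulrC.
Qed.

End Quantile.

(** * Positivity of the minimal interval length *)

Section MinLength.
Variables (R : realType) (sigma : probability (measurableTypeR R) R).
Hypothesis sigma01 : sigma `[0, 1]%classic = 1%E.
Variables (eps delta : R).
Hypothesis eps0 : 0 < eps.
Local Notation tr A := (fine (atom_trunc sigma eps A)).
Hypothesis M0 : 0 < tr setT.

Let htr := dominated_content_trunc sigma (ltW eps0).

Lemma atom_trunc_normalized_ge (A : set (measurableTypeR R)) : measurable A ->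
  (delta%:E <= atom_trunc_normalized sigma eps A)%E = (delta * tr setT <= tr A).
Proof.
move=> mA; rewrite /atom_trunc_normalized.
have h (B : set (measurableTypeR R)) : measurable B -> atom_trunc sigma eps B = (tr B)%:E.
  move=> mB; rewrite fineK// fin_numB fin_num_measure//=.
  by rewrite fin_num_atom_excess// ltW.
rewrite (h A)// (h setT)// inver gt_eqF// lee_fin.
by rewrite ler_pdivlMr.
Qed.

Lemma min_length_le x y : delta * tr setT <= tr `[x, y] ->
  min_length (atom_trunc_normalized sigma eps) delta <= `|x - y|.
Proof.
move=> h; apply: ge_inf; first by exists 0 => _ [? [? [_ ->]]].
by exists x, y; rewrite atom_trunc_normalized_ge.
Qed.

(** After truncation the atom at [p] weighs at most [eps], and a small interval adds at most half
    the remaining room. *)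
Lemma trunc_small_ball p : eps < delta * tr setT ->
  exists2 h, 0 < h & tr `[p - h, p + h] < delta * tr setT.
Proof.
set t := delta * _ => et.
have [|h h0 hh] := @prob_closed_ball _ sigma p ((t - eps) / 2).
  by rewrite divr_gt0// subr_gt0.
exists h => //; rewrite fine_atom_trunc ?(ltW eps0)//.
have [h1 _ _] := dominated_content_excess sigma (ltW eps0).
have [hp|hp] := leP (sigma [set p]) eps%:E.
  have hp' : fine (sigma [set p]) <= eps.
    by rewrite -lee_fin fineK// fin_num_measure.
  have := h1 `[p - h, p + h]%classic (measurable_itv _).
  by move: hh hp' et; lra.
have := @atom_excess_atom _ sigma eps `[p - h, p + h]%classic p.
rewrite /= in_itv/= lerDl lerBlDr lerDl (ltW h0) => /(_ isT hp).
have mI : measurable (`[p - h, p + h]%classic : set (measurableTypeR R)) by [].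
rewrite -[X in (_ <= X)%E]fineK ?fin_num_atom_excess ?(ltW eps0)//.
rewrite -[sigma [set p]]fineK ?fin_num_measure// -EFinB lee_fin.
by move: hh et; lra.
Qed.

(** By compactness of [[0, 1]] one radius works in [trunc_small_ball] for all centres. A shorter
    interval either meets [[0, 1]] and lies in such a ball, or carries no mass. *)
Lemma min_length_gt0 : eps < delta * tr setT -> delta <= 1 ->
  0 < min_length (atom_trunc_normalized sigma eps) delta.
Proof.
move=> et d1; have [h1 _ h3] := htr; set t := delta * _ in et.
have t0 : 0 < t by exact: lt_trans et.
have : \forall h \near 0^'+, `[0 : R, 1] `<=` [set p | tr `[p - h, p + h] < t].
  apply: (iffLR (compact_near_coveringP _) (@segment_compact R 0 1)) => p _.
  have [h h0 hh] := trunc_small_ball p et.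
  have hh2 : 0 < h / 2 by rewrite divr_gt0.
  near=> q e; apply: le_lt_trans hh; apply: (dominated_content_le htr) => //.
  have : `|p - q| < h / 2.
    by near: q; exact: nbhsx_ballx.
  have : e < h / 2 by near: e; exact: nbhs_right_lt.
  by move=> h4; rewrite ltr_norml => /andP[h5 h6] z /=; rewrite !in_itv/=; lra.
move=> [h0 /= h00 hball].
have h2 : 0 < h0 / 2 by rewrite divr_gt0.
have hs : `[0 : R, 1] `<=` [set p | tr `[p - h0 / 2, p + h0 / 2] < t].
  by apply: hball => //=; rewrite sub0r normrN gtr0_norm// ltr_pdivrMr//; lra.
apply: lt_le_trans h2 _; apply: lb_le_inf.
  exists `|0 - 1|, 0, 1; split=> //; rewrite atom_trunc_normalized_ge//.
  by rewrite (dominated_content_full htr sigma01 (A := setT))// ler_piMl//; case: htr => + _ _; apply.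
move=> _ [x [y [+ ->]]]; rewrite atom_trunc_normalized_ge// -/t => txy.
rewrite leNgt; apply/negP => xyh.
have [[q [xqy q01]]|] := pselect (exists q : R, `[x, y]%classic q /\ `[0, 1]%classic q).
  have := hs q q01; rewrite /= ltNge => /negP; apply.
  apply: le_trans txy _; apply: (dominated_content_le htr) => // z /=.
  move: xqy; rewrite /= !in_itv/=; move: xyh; rewrite ltr_norml; lra.
move=> /forallNP hq; move: txy; rewrite leNgt => /negP; apply.
rewrite (dominated_content_supp htr sigma01)//.
by apply/seteqP; split=> z //= zz; case: (hq z).
Unshelve. all: by end_near.
Qed.

End MinLength.

(** * Moments of measures with close distribution functions *)

Section Koksma.
Variable R : realType.

Lemma exprB_le (a b : R) j : 0 <= a -> a <= b -> b <= 1 ->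
  b ^+ j - a ^+ j <= j%:R * (b - a).
Proof.
move=> a0 ab b1; elim: j => [|j IHj]; first by rewrite !expr0 subrr mul0r.
have b0 := le_trans a0 ab; have a1 := le_trans ab b1.
have bj : b ^+ j <= 1 by rewrite exprn_ile1.
have bj0 : 0 <= b ^+ j by rewrite exprn_ge0.
rewrite !exprS -natr1 mulrDl mul1r.
rewrite (_ : b * b ^+ j - a * a ^+ j = a * (b ^+ j - a ^+ j) + b ^+ j * (b - a)); last by ring.
apply: lerD; last by rewrite ler_piMl// subr_ge0.
apply: le_trans IHj; rewrite ler_piMl// subr_ge0.
by rewrite lerXn2r// nnegrE.
Qed.

(** A staircase above [y^j] on the grid of step [1/L]. As a combination of indicators of half-lines,
    its averages depend only on the distribution function. *)
Definition stair (j L : nat) (y : R) : R :=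
  \sum_(l < L) ((l.+1%:R / L%:R) ^+ j - (l%:R / L%:R) ^+ j) *
    (l%:R / L%:R < y)%R%:R.

Lemma stair_approx j L y : (0 < j)%N -> (0 < L)%N -> 0 <= y <= 1 ->
  y ^+ j <= stair j L y <= y ^+ j + j%:R / L%:R.
Proof.
move=> j0 L0 /andP[y0 y1]; have LR : 0 < L%:R :> R by rewrite ltr0n.
pose s l := l%:R / L%:R : R.
pose S K := \sum_(l < K) (s l.+1 ^+ j - s l ^+ j) * (s l < y)%R%:R.
have s0 l : 0 <= s l by rewrite divr_ge0.
have ss l : s l.+1 = s l + L%:R^-1 by rewrite /s -natr1 mulrDl mul1r.
(* The partial sums telescope to [s K ^+ j] until the grid passes [y], and are constant from then
   on. *)
suff h K : (K <= L)%N -> if y <= s K then y ^+ j <= S K <= y ^+ j + j%:R / L%:R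
    else S K == s K ^+ j.
  by have := h L (leqnn L); rewrite (_ : s L = 1) ?y1// /s divff ?gt_eqF.
elim: K => [|K IHK] KL.
  rewrite /S big_ord0 /s mul0r expr0n gtn_eqF//=; case: ifP => // y0'.
  have -> : y = 0 by apply/eqP; rewrite eq_le y0' y0.
  by rewrite expr0n gtn_eqF//= lexx add0r divr_ge0.
have := IHK (ltnW KL); rewrite /S big_ord_recr /= -/(S K).
have [yK|Ky] := leP y (s K) => hS.
  rewrite (_ : y <= s K.+1) ?mulr0 ?addr0//.
  by rewrite ss (le_trans yK)// lerDl invr_ge0 ltW.
rewrite (eqP hS) mulr1 addrC subrK; case: ifP => // yK.
have sK1 : s K.+1 <= 1 by rewrite /s ler_pdivrMr// mul1r ler_nat.
rewrite lerXn2r ?nnegrE//=; have := exprB_le j y0 yK sK1.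
have : j%:R * (s K.+1 - y) <= j%:R * L%:R^-1.
  by rewrite ler_wpM2l// ss; move: Ky; lra.
by lra.
Qed.

Lemma grid_weight_ge0 j L l :
  0 <= (l.+1%:R / L%:R) ^+ j - (l%:R / L%:R) ^+ j :> R.
Proof.
rewrite subr_ge0 lerXn2r ?nnegrE ?divr_ge0// ler_wpM2r ?invr_ge0//.
by rewrite ler_nat.
Qed.

Lemma sum_grid_weight j L : (0 < j)%N -> (0 < L)%N ->
  \sum_(l < L) ((l.+1%:R / L%:R) ^+ j - (l%:R / L%:R) ^+ j) = 1 :> R.
Proof.
move=> j0 L0; rewrite -(big_mkord xpredT (fun l => (l.+1%:R / L%:R) ^+ j - (l%:R / L%:R) ^+ j)).
rewrite telescope_sumr// divff ?pnatr_eq0 -?lt0n//.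
by rewrite mul0r expr0n gtn_eqF// expr1n subr0.
Qed.

Variable sigma : probability (measurableTypeR R) R.
Hypothesis sigma01 : sigma `[0, 1]%classic = 1%E.

Lemma prob_gt_inter01 (s : R) :
  sigma (`]s, +oo[%classic `&` `[0, 1]%classic) =
  (1 - fine (sigma `]-oo, s]%classic))%:E.
Proof.
have hP := dominated_content_prob sigma; have [_ _ h3] := hP.
have mI : measurable (`]s, +oo[%classic : set (measurableTypeR R)).
  exact: measurable_itv.
have mJ : measurable (`]-oo, s]%classic : set (measurableTypeR R)).
  exact: measurable_itv.
have mID : measurable (`]s, +oo[%classic `&` `[0, 1]%classic : set (measurableTypeR R)).
  exact: measurableI.
have mID' : measurable (`]s, +oo[%classic `\` `[0, 1]%classic : set (measurableTypeR R)).
  exact: measurableD.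
rewrite -[LHS]fineK ?fin_num_measure//; congr (_%:E).
have h1 : fine (sigma setT) = 1 by rewrite probability_setT.
have <- : fine (sigma `]s, +oo[%classic) =
    fine (sigma (`]s, +oo[%classic `&` `[0, 1]%classic)).
  rewrite -[in LHS](setUIDK `]s, +oo[%classic `[0, 1]%classic) h3//; last first.
    by rewrite setDE setIACA setICr setI0.
  rewrite (dominated_content_supp hP sigma01 mID') ?addr0//.
  by rewrite setDE -setIA setICl setI0.
have hT : `]-oo, s]%classic `|` `]s, +oo[%classic = [set: R].
  by apply/seteqP; split=> z //= _; rewrite !in_itv/=; case: (leP z s) => h; [left|right].
have hI : `]-oo, s]%classic `&` `]s, +oo[%classic = set0.
  by apply/seteqP; split=> z //= []; rewrite !in_itv/= andbT => zs; rewrite ltNge zs.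
have := h3 _ _ mJ mI hI; rewrite hT h1 => ->.
by rewrite addrAC subrr add0r.
Qed.

Lemma integral_stair j L :
  (\int[sigma]_(y in `[0%R, 1%R]%classic) (stair j L y)%:E =
   (\sum_(l < L) ((l.+1%:R / L%:R) ^+ j - (l%:R / L%:R) ^+ j) *
     (1 - fine (sigma `]-oo, (l%:R / L%:R)%R]%classic)))%:E)%E.
Proof.
pose D l : R := (l.+1%:R / L%:R) ^+ j - (l%:R / L%:R) ^+ j.
pose I l : set (measurableTypeR R) := `]l%:R / L%:R, +oo[%classic.
have mI l : measurable (I l) by exact: measurable_itv.
have mf l : measurable_fun [set: measurableTypeR R] (EFin \o (\1_(I l) : R -> R)).
  by apply/measurable_EFinP; exact: measurable_indic.
rewrite (eq_integral (fun y => \sum_(l < L) (D l)%:E * (\1_(I l) y)%:E)%E); last first.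
  move=> y _; rewrite /stair -sumEFin; apply: eq_bigr => l _.
  by rewrite EFinM indicE; congr (_ * (_%:R)%:E)%E; rewrite /I mem_setE in_itv/= andbT.
rewrite ge0_integral_sum//.
- rewrite -sumEFin; apply: eq_bigr => l _.
  rewrite ge0_integralZl_EFin ?grid_weight_ge0//; last exact: measurable_funTS (mf l).
  by rewrite integral_indic// EFinM; congr (_ * _)%E; exact: prob_gt_inter01.
- move=> l; apply: measurable_funeM; exact: measurable_funTS (mf l).
- by move=> l y _; rewrite mule_ge0// lee_fin grid_weight_ge0.
Qed.

Lemma integral_expr01 j :
  (\int[sigma]_y (y ^+ j)%:E = \int[sigma]_(y in `[0%R, 1%R]%classic) (y ^+ j)%:E)%E.
Proof.
have mf : measurable_fun [set: measurableTypeR R] (EFin \o (fun y : R => y ^+ j)).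
  by apply/measurable_EFinP; exact: measurable_funX.
have mD : measurable (~` `[0%R, 1%R]%classic : set (measurableTypeR R)).
  exact: measurableC.
have s0 : sigma (~` `[0%R, 1%R]%classic) = 0%E.
  by rewrite probability_setC// sigma01 subee.
rewrite -(setUv `[0%R, 1%R]%classic) integral_setU//; last 2 first.
- by rewrite setUv.
- exact/disj_setPCl.
rewrite [X in (_ + X)%E]null_set_integral ?adde0//; first exact: measurable_funTS mf.
Qed.

Lemma measurable_stair j L : measurable_fun [set: measurableTypeR R] (stair j L).
Proof.
apply: measurable_sum => l; apply: measurable_funM; first exact: measurable_cst.
rewrite (_ : (fun y => _) = \1_(`](l%:R / L%:R : R), +oo[%classic)).
  by apply: measurable_indic; exact: measurable_itv.
by apply/funext => y; rewrite indicE mem_setE in_itv/= andbT.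
Qed.

(** Integration of [stair_approx]; its lower half also shows the moment to be finite, so [fine]
    loses nothing. *)
Lemma integral_expr_bounds j L : (0 < j)%N -> (0 < L)%N ->
  let m := fine (\int[sigma]_y (y ^+ j)%:E)%E in
  let s := \sum_(l < L) ((l.+1%:R / L%:R) ^+ j - (l%:R / L%:R) ^+ j) *
     (1 - fine (sigma `]-oo, (l%:R / L%:R)%R]%classic)) in
  (\int[sigma]_y (y ^+ j)%:E = m%:E)%E /\ m <= s <= m + j%:R / L%:R.
Proof.
move=> j0 L0; have LR : 0 < L%:R :> R by rewrite ltr0n.
have := integral_stair j L; set s := \sum_(l < L) _ => hs m.
have mf : measurable_fun [set: measurableTypeR R] (EFin \o (fun y : R => y ^+ j)).
  by apply/measurable_EFinP; exact: measurable_funX.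
have ms : measurable_fun [set: measurableTypeR R] (EFin \o (stair j L)).
  by apply/measurable_EFinP; exact: measurable_stair.
have D01 (y : R) : `[0%R, 1%R]%classic y -> 0 <= y <= 1 by rewrite /= in_itv.
have f0 (y : R) : `[0%R, 1%R]%classic y -> (0%R <= (y ^+ j)%:E)%E.
  by move=> /D01/andP[y0 _]; rewrite lee_fin exprn_ge0.
have s0 (y : R) : `[0%R, 1%R]%classic y -> (0%R <= (stair j L y)%:E)%E.
  move=> /D01 /(stair_approx j0 L0)/andP[+ _] => h; rewrite lee_fin.
  rewrite /stair; apply: sumr_ge0 => l _; rewrite mulr_ge0//.
  exact: grid_weight_ge0.
have h1 : (\int[sigma]_y (y ^+ j)%:E <= s%:E)%E.
  rewrite integral_expr01 -hs; apply: ge0_le_integral => //;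
    [exact: measurable_funTS mf|exact: measurable_funTS ms|].
  by move=> y /D01 /(stair_approx j0 L0)/andP[h _]; rewrite lee_fin.
have h0 : (0 <= \int[sigma]_y (y ^+ j)%:E)%E.
  by rewrite integral_expr01; apply: integral_ge0.
have mE : (\int[sigma]_y (y ^+ j)%:E = m%:E)%E.
  by rewrite /m fineK// ge0_fin_numE// (le_lt_trans h1)// ltry.
split=> //; rewrite -!lee_fin -mE h1/= EFinD -mE integral_expr01 -hs.
have c0 : 0 <= j%:R / L%:R :> R by rewrite divr_ge0.
rewrite (_ : (j%:R / L%:R)%:E = \int[sigma]_(y in `[0%R, 1%R]%classic) (j%:R / L%:R)%:E)%E; last first.
  by rewrite integral_cst// (_ : _ `[0, 1]%classic = 1%E) ?mule1.
rewrite -ge0_integralD//; last exact: measurable_funTS mf.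
apply: ge0_le_integral => //; first exact: measurable_funTS ms.
  by apply: emeasurable_funD; [exact: measurable_funTS mf|exact: measurable_cst].
by move=> y /D01 /(stair_approx j0 L0)/andP[_ h]; rewrite -EFinD lee_fin.
Qed.

(** With [stair] in place of [y^j], the difference is an average of differences of distribution
    functions with weights of sum 1. The grid error tends to 0. *)
Lemma koksma n (x : 'I_n -> R) (C : R) j : (0 < j)%N ->
  (forall i, 0 <= x i <= 1) ->
  (forall s, 0 <= s <= 1 ->
    `|n%:R * fine (sigma `]-oo, s]%classic) - \sum_(i < n) (x i <= s)%R%:R| <= C) ->
  let m := fine (\int[sigma]_y (y ^+ j)%:E)%E in
  (\int[sigma]_y (y ^+ j)%:E = m%:E)%E /\
  `|n%:R * m - \sum_(i < n) x i ^+ j| <= C.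
Proof.
move=> j0 x01 hC m; split; first by have [] := @integral_expr_bounds j 1 j0 isT.
apply/ler_addgt0Pr => e e0.
have nj : 0 < (n * j).+1%:R :> R by rewrite ltr0n.
have [L] := @ltr_add_invr R 0 (e / (n * j).+1%:R) (divr_gt0 e0 nj).
rewrite add0r ltr_pdivlMr// => hL.
have hL' : n%:R * (j%:R / L.+1%:R) <= e.
  apply: le_trans (ltW hL); rewrite mulrA mulrC ler_pM2l ?invr_gt0 ?ltr0n//.
  by rewrite -natrM ler_nat.
have [_] := @integral_expr_bounds j L.+1 j0 isT; rewrite -/m.
set s := \sum_(l < L.+1) _ => /andP[m1 m2].
have n1 : n%:R * m <= n%:R * s by rewrite ler_wpM2l.
have n2 : n%:R * s <= n%:R * m + n%:R * (j%:R / L.+1%:R) by rewrite -mulrDr ler_wpM2l.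
have p1 : \sum_(i < n) x i ^+ j <= \sum_(i < n) stair j L.+1 (x i).
  by apply: ler_sum => i _; have /andP[] := stair_approx j0 (ltn0Sn L) (x01 i).
have p2 : \sum_(i < n) stair j L.+1 (x i) <=
    \sum_(i < n) x i ^+ j + n%:R * (j%:R / L.+1%:R).
  rewrite [X in _ + X](_ : _ = \sum_(i < n) (j%:R / L.+1%:R)); last first.
    by rewrite sumr_const card_ord mulr_natl.
  rewrite -big_split; apply: ler_sum => i _.
  by have /andP[] := stair_approx j0 (ltn0Sn L) (x01 i).
have : `|n%:R * s - \sum_(i < n) stair j L.+1 (x i)| <= C.
  rewrite [X in _ - X]exchange_big /= /s mulr_sumr -sumrB.
  apply: le_trans (ler_norm_sum _ _ _) _.
  apply: (@le_trans _ _ (\sum_(l < L.+1) ((l.+1%:R / L.+1%:R) ^+ j - (l%:R / L.+1%:R) ^+ j) * C)).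
    apply: ler_sum => l _; rewrite -mulr_sumr mulrCA -mulrBr normrM.
    rewrite ger0_norm ?grid_weight_ge0// ler_wpM2l ?grid_weight_ge0//.
    have l01 : 0 <= (l%:R / L.+1%:R : R) <= 1.
      by rewrite divr_ge0//= ler_pdivrMr ?ltr0n// mul1r ler_nat ltnW.
    have := hC _ l01.
    rewrite (_ : \sum_(i < n) (l%:R / L.+1%:R < x i)%R%:R =
      n%:R - \sum_(i < n) (x i <= l%:R / L.+1%:R)%R%:R).
      rewrite distrC; set F := fine _; set S := \sum_(i < n) _.
      by rewrite (_ : S - _ = n%:R * (1 - F) - (n%:R - S)); last by ring.
    rewrite -[in n%:R](card_ord n) -sumr_const -sumrB; apply: eq_bigr => i _.
    by rewrite ltNge; case: (_ <= _); rewrite ?subrr ?subr0.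
  by rewrite -mulr_suml sum_grid_weight// mul1r.
move=> /ler_normlP[q1 q2]; apply/ler_normlP.
move: hL' n1 n2 p1 p2 q1 q2; clear; set a := \sum_(i < n) _; set b := \sum_(i < n) _.
set c := n%:R * (j%:R / _); set u := n%:R * m; set v := n%:R * s.
by move=> *; split; lra.
Qed.

End Koksma.

(** * The quantile points *)

(** The sum counts the positive integers up to [t], so it is the integer part of [t]. *)
Lemma sum_le_nat (R : realDomainType) N (t : R) : 0 <= t -> t < N.+1%:R ->
  \sum_(a < N) (a.+1%:R <= t)%R%:R <= t <= \sum_(a < N) (a.+1%:R <= t)%R%:R + 1.
Proof.
move=> t0; elim: N => [|N IHN] tN; first by rewrite big_ord0 t0 add0r ltW.
have [Nt|Nt] := leP N.+1%:R t; last first.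
  rewrite big_ord_recr /=; have := IHN Nt.
  by rewrite [N.+1%:R <= t]leNgt Nt /= addr0.
rewrite (eq_bigr (fun=> 1)) => [|a _]; last first.
  by rewrite (le_trans _ Nt)// ler_nat.
by rewrite sumr_const card_ord Nt natr1 ltW.
Qed.

(** Indices are grouped by residue modulo [T]; each residue is one group of nodes. *)
Lemma sum_residues (V : nmodType) (f : nat -> V) k T :
  \sum_(T <= a < k.+1 * T) f a = \sum_(s < T) \sum_(i < k) f (s + i.+1 * T)%N.
Proof.
elim: k => [|k IHk].
  by rewrite mul1n big_geq// big1// => s _; rewrite big_ord0.
rewrite (big_cat_nat (n := (k.+1 * T)%N))?leq_pmull ?leq_mul2r ?leqnSn ?orbT//=.
rewrite IHk -{1}[(k.+1 * T)%N]add0n big_addn mulSn addnK big_mkord -big_split.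
by apply: eq_bigr => s _; rewrite big_ord_recr.
Qed.

Section Points.
Variables (R : realType) (sigma : probability (measurableTypeR R) R).
Hypothesis sigma01 : sigma `[0, 1]%classic = 1%E.
Variable eps : R.
Hypothesis eps0 : 0 < eps.
Local Notation tr A := (fine (atom_trunc sigma eps A)).

(** Either no atom exceeds [eps] and the mass is still 1, or a large atom keeps mass at least
    [eps]. *)
Lemma atom_trunc_gt0 : 0 < tr setT.
Proof.
have htr := dominated_content_trunc sigma (ltW eps0).
have [[p hp]|] := pselect (exists p, (eps%:E < sigma [set p])%E); last first.
  move=> /forallNP h; rewrite fine_atom_trunc ?(ltW eps0)// probability_setT.
  rewrite (_ : atom_excess _ _ _ = 0%E) ?subr0//.
  by apply: esum1 => x /= /h.
apply: lt_le_trans (dominated_content_le htr (A := [set p]) _ _ _) => //.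
apply: lt_le_trans eps0 _; rewrite fine_atom_trunc ?(ltW eps0)//.
suff : (atom_excess sigma eps [set p] <= sigma [set p] - eps%:E)%E.
  rewrite -[X in (X <= _)%E]fineK ?fin_num_atom_excess ?(ltW eps0)//.
  by rewrite -[sigma [set p]]fineK ?fin_num_measure// -EFinB lee_fin; lra.
apply: ge_ereal_sup => _ /= [Y [finY YS] <-].
rewrite (eq_fsbigr (fun x => if x \in [set p] then sigma [set x] - eps%:E else 0)%E); last first.
  by move=> x _; rewrite diracE; case: ifP => _; rewrite ?mule1 ?mule0.
rewrite -fsbig_mkcondr.
apply: (@le_trans _ _ (\sum_(x \in [set p]) (sigma [set x] - eps%:E))%E); last first.
  by rewrite fsbig_set1.
have finYp : finite_set (Y `&` [set p]) by exact: finite_setIl.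
apply: lee_fsum_nneg_subset => //; first by move=> x; rewrite !inE => -[].
move=> x; rewrite inE/= => /andP[_]; rewrite in_setE/= => ->.
have : (0 <= sigma [set p] - eps%:E)%E by rewrite sube_ge0// ltW.
by [].
Qed.

(** Rounding the counts of the truncated part and of the excess loses at most 1 each. A leftover
    point acts in the opposite direction, so the total error stays within 2. *)
Lemma quantile_points n : (0 < n)%N -> exists x : nat -> R,
  [/\ forall i, 0 <= x i <= 1,
      forall s, 0 <= s <= 1 ->
        `|n%:R * fine (sigma `]-oo, s]%classic) -
          \sum_(i < n) (x i <= s)%R%:R| <= 2 &
      forall a, a.+1%:R <= n%:R * tr `[0, 1] ->
        forall s, (x a <= s) = (a.+1%:R <= n%:R * tr `]-oo, s])].
Proof.
move=> n0; have nR : 0 < n%:R :> R by rewrite ltr0n.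
have htr := dominated_content_trunc sigma (ltW eps0).
have hex := dominated_content_excess sigma (ltW eps0).
have h1 : `[0 : R, 1] `<=` `]-oo, 1].
  by move=> z /=; rewrite !in_itv/= => /andP[].
have [w1 hw1] := quantiles htr sigma01 n0.
have [w2 hw2] := quantiles hex sigma01 n0.
pose X1 s := n%:R * tr `]-oo, s].
pose X2 s := n%:R * fine (atom_excess sigma eps `]-oo, s]).
have XE s : n%:R * fine (sigma `]-oo, s]%classic) = X1 s + X2 s.
  by rewrite /X1 /X2 -mulrDr fine_atom_trunc ?(ltW eps0)// subrK.
have X12 : X1 1 + X2 1 = n%:R.
  rewrite -XE (dominated_content_full (dominated_content_prob sigma) sigma01)//.
  by rewrite sigma01 mulr1.
have X1_ge0 s : 0 <= X1 s by rewrite mulr_ge0//; case: htr => + _ _; apply.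
have X2_ge0 s : 0 <= X2 s by rewrite mulr_ge0//; case: hex => + _ _; apply.
have X1_le s : s <= 1 -> X1 s <= X1 1.
  by move=> s1; rewrite ler_wpM2l// (dominated_content_cdf_le htr).
have X2_le s : s <= 1 -> X2 s <= X2 1.
  by move=> s1; rewrite ler_wpM2l// (dominated_content_cdf_le hex).
pose N1 := Num.truncn (X1 1); pose N2 := Num.truncn (X2 1).
have /andP[N1l N1u] := truncn_itv (X1_ge0 1).
have /andP[N2l N2u] := truncn_itv (X2_ge0 1).
have Nle : (N1 + N2 <= n)%N.
  by rewrite -(ler_nat R) natrD -X12 lerD.
have Ngt : (n <= N1 + N2 + 1)%N.
  have : (n < N1.+1 + N2.+1)%N by rewrite -(ltr_nat R) -X12 natrD ltrD.
  by rewrite addSn addnS ltnS addn1.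
(* Quantiles of the truncated part come first, then those of the excess; at most one index below [n]
   remains and is placed at 0. *)
pose x i := if (i < N1)%N then w1 i else if (i < N1 + N2)%N then w2 (i - N1)%N else 0.
have aN1 a : (a < N1)%N -> a.+1%:R <= X1 1.
  by move=> aN; rewrite (le_trans _ N1l)// ler_nat.
have aN2 a : (a < N2)%N -> a.+1%:R <= X2 1.
  by move=> aN; rewrite (le_trans _ N2l)// ler_nat.
exists x; split.
- move=> i; rewrite /x; case: ltnP => iN1; first by have [] := hw1 _ (aN1 _ iN1).
  case: ltnP => iN2; last by rewrite lexx ler01.
  have iN : (i - N1 < N2)%N by rewrite ltn_subLR.
  by have [] := hw2 _ (aN2 _ iN).
- move=> s /andP[s0 s1]; rewrite XE.
  rewrite -(big_mkord xpredT (fun i => (x i <= s)%R%:R)).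
  rewrite (big_cat_nat (n := N1)) ?(leq_trans (leq_addr _ _) Nle)//=.
  rewrite (big_cat_nat (n := (N1 + N2)%N) (m := N1)) ?leq_addr//=.
  rewrite (_ : \sum_(0 <= i < N1) _ = \sum_(a < N1) (a.+1%:R <= X1 s)%R%:R); last first.
    rewrite big_mkord; apply: eq_bigr => a _; rewrite /x ltn_ord.
    by have [_ ->] := hw1 _ (aN1 _ (ltn_ord a)).
  rewrite (_ : \sum_(N1 <= i < N1 + N2) _ = \sum_(a < N2) (a.+1%:R <= X2 s)%R%:R); last first.
    rewrite -{1}[N1]add0n big_addn addKn big_mkord; apply: eq_bigr => a _.
    rewrite /x ltnNge leq_addl/= addnC ltn_add2l ltn_ord addKn.
    by have [_ ->] := hw2 _ (aN2 _ (ltn_ord a)).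
  rewrite (_ : \sum_(N1 + N2 <= i < n) _ = (n - (N1 + N2))%:R); last first.
    rewrite big_nat_cond (eq_bigr (fun=> 1)) => [|i /andP[/andP[Ni _] _]].
      by rewrite -big_nat_cond sumr_const_nat.
    by rewrite /x !ltnNge (leq_trans (leq_addr _ _) Ni)/= Ni/= s0.
  have /andP[h2 h3] := sum_le_nat (X1_ge0 s) (le_lt_trans (X1_le s s1) N1u).
  have /andP[h4 h5] := sum_le_nat (X2_ge0 s) (le_lt_trans (X2_le s s1) N2u).
  have h6 : (n - (N1 + N2))%:R <= 1 :> R by rewrite (_ : 1 = 1%:R)// ler_nat leq_subLR.
  have h7 : 0 <= (n - (N1 + N2))%:R :> R by [].
  move: h2 h3 h4 h5 h6 h7; set a := \sum_(_ < _) _; set b := \sum_(_ < _) _.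
  set c := (n - _)%:R; set u := X1 s; set v := X2 s => *.
  by apply/ler_normlP; split; lra.
- move=> a ha s.
  have ha1 : a.+1%:R <= X1 1.
    by rewrite /X1 (dominated_content_full htr sigma01).
  by rewrite /x truncn_gt_nat ha1; have [_ ->] := hw1 _ ha1.
Qed.

(** Just below [x a] the truncated distribution function is less than [(a + 1)/n], and at
    [x (a + T)] it is at least [(a + T + 1)/n]. The mass in between exceeds [T/n], hence [delta]
    after normalization. *)
Lemma quantile_gap n (x : nat -> R) (delta : R) T a :
  (0 < n)%N ->
  (forall a, a.+1%:R <= n%:R * tr `[0, 1] ->
     forall s, (x a <= s) = (a.+1%:R <= n%:R * tr `]-oo, s])) ->
  n%:R * (delta * tr setT) <= T%:R -> (a + T).+1%:R <= n%:R * tr `[0, 1] ->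
  min_length (atom_trunc_normalized sigma eps) delta <= x (a + T)%N - x a.
Proof.
move=> n0 hx hT haT; have nR : 0 < n%:R :> R by rewrite ltr0n.
have htr := dominated_content_trunc sigma (ltW eps0).
have ha : a.+1%:R <= n%:R * tr `[0, 1].
  by apply: le_trans haT; rewrite ler_nat ltnS leq_addr.
apply/ler_addgt0Pr => e e0.
have hv := hx _ haT (x (a + T)%N); rewrite lexx in hv; move/esym : hv => hv.
have hu := hx _ ha (x a - e); rewrite leNgt ltrBlDr ltrDl e0/= in hu.
have {}hu : n%:R * tr `]-oo, x a - e] < a.+1%:R by rewrite ltNge -hu.
have uv : x a - e <= x (a + T)%N.
  rewrite leNgt; apply/negP => /ltW vu.
  have := dominated_content_cdf_le htr vu; rewrite -(ler_pM2l nR) => h.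
  have := lt_le_trans (le_lt_trans (le_trans hv h) hu) (_ : a.+1%:R <= (a + T).+1%:R).
  by rewrite ltxx ler_nat ltnS leq_addr => /(_ isT).
have -> : x (a + T)%N - x a + e = `|x a - e - x (a + T)%N|.
  by rewrite distrC ger0_norm ?subr_ge0//; ring.
apply: (min_length_le eps0 (atom_trunc_gt0)).
have h := dominated_content_cdf htr uv.
apply: (@le_trans _ _ (tr `]x a - e, x (a + T)%N])); last first.
  apply: (dominated_content_le htr) => // z /=; rewrite !in_itv/= => /andP[/ltW -> ->] //.
rewrite -(ler_pM2l nR); apply: le_trans hT _.
move: hv hu; rewrite h mulrDr -addSn natrD; lra.
Qed.

End Points.

(** * Choice of the group size and assembly of the theorem *)

Unset Implicit Arguments.

Theorem theorem1p5 (R : realType) (sigma : probability (measurableTypeR R) R)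
    (sigma01 : sigma `[0, 1]%classic = 1%E)
    (k : nat) (k_ge2 : (2 <= k)%N)
    (eps : R) (eps_gt0 : 0 < eps) (eps_lt1 : eps < 1)
    (heps : eps / fine (atom_trunc sigma eps `[0, 1]%classic)
            < 2 / (2 * k%:R + 7)) :
  let rho := (k%:R - 1) *
    min_length (atom_trunc_normalized sigma eps) (2 / (2 * k%:R + 7)) in
  let r := rho / (6 * (k%:R + 3)) * (rho / (12 * expR 1)) ^+ (k - 1) in
  forall n : nat,
    Num.max (1 / (r * fine (atom_trunc sigma eps `[0, 1]%classic)))
            ((2 * k%:R + 6) / eps) <= n%:R ->
  exists x : 'I_n -> R,
    (forall i, 0 <= x i <= 1) /\
    (forall j : nat, (1 <= j <= k)%N ->
      ((n%:R^-1 * \sum_(i < n) x i ^+ j)%:E = \int[sigma]_y (y ^+ j)%:E)%E).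
Proof.
have htr := dominated_content_trunc sigma (ltW eps_gt0).
have ME := dominated_content_full htr sigma01 measurableT (fun _ _ => I).
have M0 := atom_trunc_gt0 sigma eps_gt0.
set M := fine (atom_trunc sigma eps `[0, 1]%classic) in heps *.
rewrite ME -/M in M0.
have M1 : M <= 1.
  have [_ h _] := htr; apply: le_trans (h `[0, 1]%classic _) _ => //.
  by rewrite sigma01.
set delta := 2 / (2 * k%:R + 7) in heps *.
set r0 := min_length _ _ => rho r n.
have kR : 2 <= k%:R :> R by rewrite ler_nat.
have k7 : 0 < 2 * k%:R + 7 :> R by lra.
have k3 : 0 < k%:R + 3 :> R by lra.
have hdM : eps < delta * M by rewrite -ltr_pdivrMr.
have delta1 : delta <= 1 by rewrite ler_pdivrMr// mul1r; lra.
have r0_gt0 : 0 < r0 by apply: min_length_gt0 => //; rewrite ME.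
have rho_gt0 : 0 < rho by apply: mulr_gt0 => //; lra.
have r_gt0 : 0 < r.
  by apply: mulr_gt0; [|apply: exprn_gt0]; apply: divr_gt0 => //; apply: mulr_gt0;
    rewrite ?expR_gt0.
rewrite ge_max => /andP[hn1 hn2].
rewrite ler_pdivrMr in hn1; last exact: mulr_gt0.
rewrite ler_pdivrMr// in hn2.
have n0 : (0 < n)%N.
  rewrite lt0n; apply/eqP => n0; move: hn2; rewrite n0 mul0r; lra.
have nR : 0 < n%:R :> R by rewrite ltr0n.
set X := n%:R * M.
(* From [2k + 6 <= n eps < n delta M = 2 X / (2k + 7)]. *)
have hX : (2 * k%:R + 7) * (k%:R + 3) <= X.
  have h : n%:R * eps < n%:R * (delta * M) by rewrite ltr_pM2l.
  have h' : n%:R * (delta * M) = 2 * X / (2 * k%:R + 7) by rewrite /X /delta; field; rewrite gt_eqF.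
  rewrite h' ltr_pdivlMr// in h; move: h hn2 k7; set t := n%:R * eps; nra.
have rX : 1 <= r * X by rewrite /X mulrCA mulrC in hn1 *; move: hn1; rewrite mulrC mulrA.
have X3 : 0 <= X / (k%:R + 3) by rewrite divr_ge0 ?mulr_ge0 ?(ltW M0) ?(ltW k3).
(* Rounding up gives [T > X / (k + 3) >= delta X], as [quantile_gap] requires. Since
   [X / (k + 3) >= k + 2], the extra 1 still leaves [(k + 2) T <= X], so all [k + 2] blocks consist
   of quantiles of the truncated part. *)
set T := (Num.truncn (X / (k%:R + 3))).+1.
have /andP[T1 T2] := truncn_itv X3; rewrite -/T in T2.
have T1' : T%:R <= X / (k%:R + 3) + 1 by rewrite /T -[_.+1%:R]natr1 lerD2r.
have TR : 0 < T%:R :> R by rewrite ltr0n.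
have X2 : k%:R + 2 <= X / (k%:R + 3).
  by rewrite ler_pdivlMr//; move: hX kR; nra.
have T2' : 2 <= T%:R :> R by move: (ltW T2); move: X2 kR; lra.
have hTX : (k.+2 * T)%:R <= X.
  rewrite natrM; apply: le_trans (ler_wpM2l _ T1') _ => //.
  have -> : k.+2%:R = k%:R + 2 :> R by rewrite -natrD addn2.
  have : X = X / (k%:R + 3) * (k%:R + 3) by rewrite divfK// gt_eqF.
  by move: X2; set u := X / _ => ? ->; nra.
have hTn : (k.+2 * T <= n)%N.
  by rewrite -(ler_nat R) (le_trans hTX)// /X ler_piMr.
have [x [x01 xcount xq]] := quantile_points sigma01 eps_gt0 n0.
have hTd : n%:R * (delta * fine (atom_trunc sigma eps setT)) <= T%:R.
  rewrite ME -/M; apply: le_trans (ltW T2).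
  rewrite (_ : n%:R * _ = X * delta); last by rewrite /X mulrCA mulrC mulrA.
  rewrite ler_wpM2l ?mulr_ge0 ?(ltW M0)// /delta ler_pdivrMr// ler_pdivlMl//.
  by lra.
have gap s i : (s < T)%N -> (i <= k)%N -> x (s + i * T)%N + r0 <= x (s + i.+1 * T)%N.
  move=> sT ik; rewrite mulSnr addnA -lerBrDl.
  apply: (quantile_gap eps_gt0 n0 xq hTd); rewrite -/M -/X.
  apply: le_trans hTX; rewrite ler_nat.
  by rewrite -addnA -mulSnr -addSn [leqRHS]mulSn leq_add// leq_mul2r ltnS ik orbT.
pose m j := fine (\int[sigma]_y (y ^+ j)%:E)%E.
have hm j : (0 < j)%N -> (\int[sigma]_y (y ^+ j)%:E = (m j)%:E)%E /\
    `|n%:R * m j - \sum_(i < n) x i ^+ j| <= 2.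
  by move=> j0; apply: (koksma sigma01 j0) => // s; exact: xcount.
pose v j := (n%:R * m j - \sum_(i < n) x i ^+ j) / T%:R.
pose d : R := 2 / T%:R.
have d01 : 0 <= d <= 1 by rewrite divr_ge0//= ler_pdivrMr// mul1r.
have vd j : (1 <= j <= k)%N -> `|v j| <= d.
  move=> /andP[j0 _]; have [_ h] := hm j j0.
  by rewrite /v normrM normfV (gtr0_norm TR) ler_pM2r ?invr_gt0.
(* By [perturbation_size] it is enough that [2 / T <= 2 (k + 3) r], which follows from [1 <= r X]
   and [X <= (k + 3) T]. *)
have hd : d * k%:R * 2 ^+ k < (r0 / 2) ^+ k * k`!%:R / 2 ^+ k.-1.
  have k1 : (0 < k.-1)%N by rewrite -ltnS prednK// ltnW.
  have k1E : k.-1%:R = k%:R - 1 :> R by rewrite -subn1 natrB// ltnW.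
  have := @perturbation_size R k.-1 r0 d k1 r0_gt0; rewrite prednK ?(ltnW k_ge2)//; apply.
  rewrite k1E -/rho -subn1; set Y := (rho / _) ^+ _.
  have -> : rho / 3 * Y = 2 * (k%:R + 3) * r.
    by rewrite /r -/Y; move: k3; set u := k%:R + 3 => u0; field; rewrite gt_eqF.
  rewrite /d ler_pdivrMr//.
  have hT : X <= (k%:R + 3) * T%:R by rewrite mulrC -ler_pdivrMr// ltW.
  have : r * X <= r * ((k%:R + 3) * T%:R) by rewrite ler_wpM2l// ltW.
  by move: rX; set t := r * X => h1 h2; have := le_trans h1 h2; lra.
have hz s : exists z : nat -> R, (s < T)%N -> (forall i, (i < k)%N -> 0 <= z i <= 1) /\
    forall j, (1 <= j <= k)%N ->
      \sum_(i < k) z i ^+ j = \sum_(i < k) x (s + i.+1 * T)%N ^+ j + v j.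
  have [sT|_] := ltnP s T; last by exists x.
  have [|||z zP] := @perturb_power_sums R k (fun i => x (s + i * T)%N) r0 r0_gt0
    (fun i => gap s i sT) v d _ _ _ d01 vd hd; last by exists z.
  - exact: ltnW.
  - by case/andP: (x01 (s + 0 * T)%N).
  - by case/andP: (x01 (s + k.+1 * T)%N).
have [z {}hz] := choice hz.
(* An index [a = s + (i + 1) T] is the [i]-th inner node of group [s]. The first block contains the
   left outer nodes and, like the indices from [(k + 1) T] on, is left unmoved. *)
pose x' a := if (T <= a < k.+1 * T)%N then z (a %% T)%N (a %/ T).-1 else x a.
exists (fun i => x' i); split => [i|j /[dup] jk /andP[j0 _]].
  rewrite /x'; case: ifP => // /andP[h1 h2].
  have [h3 _] := hz (i %% T)%N (ltn_pmod _ (ltn0Sn _)).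
  apply: h3; rewrite -ltnS prednK ?divn_gt0// ltn_divLR//.
have [-> _] := hm j j0; congr (_%:E).
suff -> : \sum_(i < n) x' i ^+ j = n%:R * m j by rewrite mulKf ?gt_eqF.
have -> : n%:R * m j = \sum_(i < n) x i ^+ j + T%:R * v j.
  by rewrite /v mulrCA divff ?gt_eqF// mulr1 addrC subrK.
have kT : (k.+1 * T <= n)%N by rewrite (leq_trans _ hTn)// leq_mul2r leqnSn orbT.
have split3 (f : nat -> R) : \sum_(i < n) f i = \sum_(0 <= i < T) f i +
    (\sum_(s < T) \sum_(i < k) f (s + i.+1 * T)%N) + \sum_(k.+1 * T <= i < n) f i.
  rewrite -(big_mkord xpredT f) (big_cat_nat (n := (k.+1 * T)%N))//=; congr (_ + _).
  by rewrite (big_cat_nat (n := T))//= ?leq_pmull// sum_residues.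
rewrite (split3 (fun i => x' i ^+ j)) (split3 (fun i => x i ^+ j)).
rewrite [X in X + _ + _ = _](_ : _ = \sum_(0 <= i < T) x i ^+ j); last first.
  by apply: eq_big_nat => i /andP[_ iT]; rewrite /x' leqNgt iT.
rewrite [X in _ + X = _](_ : _ = \sum_(k.+1 * T <= i < n) x i ^+ j); last first.
  by apply: eq_big_nat => i /andP[iT _]; rewrite /x' ltnNge iT andbF.
rewrite [X in _ + X + _ = _](_ : _ =
    \sum_(s < T) \sum_(i < k) x (s + i.+1 * T)%N ^+ j + T%:R * v j).
  by rewrite addrA; exact: addrAC.
rewrite (_ : T%:R * v j = \sum_(s < T) v j); last first.
  by rewrite sumr_const card_ord mulr_natl.
rewrite -big_split; apply: eq_bigr.
move=> s _ /=; have [_ hj] := hz s (ltn_ord s); rewrite -hj//.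
apply: eq_bigr => i _; have sT := ltn_ord s; rewrite /x' addnC.
rewrite modnMDl modn_small// divnMDl// divn_small// addn0 /=.
have -> : (T <= i.+1 * T + s)%N by rewrite (leq_trans _ (leq_addr _ _))// leq_pmull.
have -> // : (i.+1 * T + s < k.+1 * T)%N.
rewrite (leq_trans (_ : _ <= i.+2 * T)%N)//; first by rewrite [leqRHS]mulSnr ltn_add2l.
by rewrite leq_mul2r !ltnS ltn_ord orbT.
Qed.
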